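(* Let $g\in H(\mathbb{D})$ be such that $\log(g')\in\mathcal{B}$, let $\nu$ be an analytic weight and let $\mu$ be an arbitrary weight. Then $T_g: H^{\infty}_\nu\rightarrow H^{\infty}_\mu$ is bounded if and only if $$\sup_{0\leq t<1}\ \sup_{0\leq\theta<2\pi}\mu(t)\int_0^t\frac{|g'(re^{i\theta})|}{\nu(r)}\,dr<+\infty\,.$$
   Context: $\mathbb{D}$ is the open unit disk and $H(\mathbb{D})$ the space of analytic functions on $\mathbb{D}$. A weight is a non-negative continuous function $\nu$ on $\mathbb{D}$ with $\nu(z)=\nu(|z|)$ for all $z$, which is decreasing in $|z|$; we write $\nu(r)$ for its value at $|z|=r$. For a weight $\nu$, $H^{\infty}_\nu=\{f\in H(\mathbb{D}): \|f\|_{H^\infty_\nu}:=\sup_{z\in\mathbb{D}}\nu(z)|f(z)|<\infty\}$. The Bloch space is $\mathcal{B}=\{f\in H(\mathbb{D}): |f(0)|+\sup_{z\in\mathbb{D}}(1-|z|^2)|f'(z)|<\infty\}$; ''$\log(g')\in\mathcal{B}$'' means $g'$ has no zeros in $\mathbb{D}$ and an analytic branch of $\log g'$ belongs to $\mathcal{B}$. A weight $\nu$ is analytic if $\nu(z)=1/F(|z|)$ for some $F\in H(\mathbb{D})$ with $|F(z)|\leq F(|z|)$ for all $z\in\mathbb{D}$. For $g\in H(\mathbb{D})$, the Volterra type operator is $(T_gf)(z)=\int_0^z f(\omega)g'(\omega)\,d\omega$. *)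

(* Defs.v *)
From Stdlib Require Import Reals.
From Coquelicot Require Import Coquelicot.
Open Scope R_scope.

Definition in_disk (z : C) : Prop := Cmod z < 1.

Definition has_cderiv (f : C -> C) (z : C) (l : C) : Prop :=
  @is_derive C_AbsRing C_NormedModule f z l.

Definition analytic_on_disk (f : C -> C) : Prop :=
  forall z : C, in_disk z -> exists l : C, has_cderiv f z l.

Definition cexp (z : C) : C :=
  (exp (fst z) * cos (snd z), exp (fst z) * sin (snd z)).

Definition eitheta (theta : R) : C := (cos theta, sin theta).

Definition in_Bloch (f : C -> C) : Prop :=
  exists fp : C -> C,
    (forall z, in_disk z -> has_cderiv f z (fp z)) /\
    exists M : R, forall z, in_disk z ->
      Cmod (f (RtoC 0)) + (1 - Cmod z ^ 2) * Cmod (fp z) <= M.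

(* log(g') in B, where gp = g' : gp has an analytic logarithm h on D
   (exp o h = gp on D; in particular gp has no zeros) with h in B *)
Definition log_in_Bloch (gp : C -> C) : Prop :=
  exists h : C -> C,
    (forall z, in_disk z -> cexp (h z) = gp z) /\ in_Bloch h.

(* A weight, represented by its radial profile nu : [0,1) -> R
   (nu(z) = nu(|z|)): non-negative, continuous on [0,1), and
   decreasing (non-increasing) in |z|. *)
Definition weight (nu : R -> R) : Prop :=
  (forall r, 0 <= r < 1 -> 0 <= nu r) /\
  (forall r, 0 <= r < 1 ->
     filterlim nu (within (fun x => 0 <= x < 1) (locally r)) (locally (nu r))) /\
  (forall r s, 0 <= r -> r <= s -> s < 1 -> nu s <= nu r).

Definition analytic_weight (nu : R -> R) : Prop :=
  weight nu /\
  exists F : C -> C, analytic_on_disk F /\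
    (forall r, 0 <= r < 1 -> Cmult (RtoC (nu r)) (F (RtoC r)) = RtoC 1) /\
    (* F(|z|) is real (it equals 1/nu(|z|)), so |F(z)| <= F(|z|) reads: *)
    (forall z, in_disk z -> Cmod (F z) <= fst (F (RtoC (Cmod z)))).

(* Volterra type operator: (T_g f)(z) = int_0^z f(w) g'(w) dw along the
   segment [0,z], i.e. int_0^1 f(sz) g'(sz) z ds. gp stands for g'. *)
Definition Tg (gp f : C -> C) (z : C) : C :=
  @RInt C_R_CompleteNormedModule
    (fun s : R => Cmult (Cmult (f (Cmult (RtoC s) z)) (gp (Cmult (RtoC s) z))) z) 0 1.

(* T_g : H^oo_nu -> H^oo_mu is bounded: there is C with
   ||T_g f||_{H^oo_mu} <= C ||f||_{H^oo_nu} for every f in H^oo_nu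
   (sups written out: A bounds nu|f| on D). *)
Definition Tg_bounded (gp : C -> C) (nu mu : R -> R) : Prop :=
  exists K : R, forall f : C -> C, analytic_on_disk f ->
    forall A : R, (forall z, in_disk z -> nu (Cmod z) * Cmod (f z) <= A) ->
      forall z, in_disk z -> mu (Cmod z) * Cmod (Tg gp f z) <= K * A.

(* Main.v *)
Require Import Defs.
From Stdlib Require Import Reals ZArith Lra Lia.
From Coquelicot Require Import Coquelicot.
Open Scope R_scope.

(** Sufficiency is the triangle inequality along the radius. For necessity, fix
    a ray e^{i theta} and write g' = e^h with h Bloch. The phase
    a(r) = Im h(r e^{i theta}) is Lipschitz in the variable -ln(1-r), so it can
    be cancelled by a bounded analytic function: with u = 1 - z and u_j = q^j, take
      k(z) = sum_{j <= J} e^{-i a(1 - u_j)} (4 u u_j / (u + u_j)^2)^N.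
    For N large (in terms of the Bloch norm) and q close to 1, the kernels are so
    concentrated near u = u_j that Re (k(r) e^{i a(r)}) >= 1/8 on [0,t] once
    q^J <= 1-t, while |k| is bounded on the disc independently of J and theta.
    Testing T_g on z |-> e^{-i theta} (F k)(e^{-i theta} z), where F = 1/nu on the
    radius, bounds the radial integral. *)

(** * Complex differentiation *)

(** C carries two module structures over itself. The product rule and the inner function of the
    chain rule use the one on the right; the remainder estimates agree by conversion, so only
    linearity is proved again. *)
Lemma has_cderiv_AbsRing (f : C -> C) (z l : C) :
  has_cderiv f z l <-> @is_derive C_AbsRing (AbsRing_NormedModule C_AbsRing) f z l.
Proof.
split; intros [_ Hd]; (split; [apply is_linear_scal_l | exact Hd]).
Qed.

Lemma has_cderiv_eps (f : C -> C) (z l : C) :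
  has_cderiv f z l <->
  forall eps : R, 0 < eps -> exists d : R, 0 < d /\ forall y : C,
    Cmod (y - z) < d -> Cmod (f y - f z - (y - z) * l)%C <= eps * Cmod (y - z).
Proof.
split.
- intros [_ Hd] eps Heps.
  destruct (Hd z (fun P H => H) (mkposreal eps Heps)) as [d Hy].
  exists d; split; [apply cond_pos|].
  intros y Hyd; apply (Hy y Hyd).
- intros H; split; [apply is_linear_scal_l|].
  intros x Hx eps.
  rewrite <- (is_filter_lim_locally_unique (V := AbsRing_NormedModule C_AbsRing) _ _ Hx); clear x Hx.
  destruct (H eps (cond_pos eps)) as [d [Hd Hy]].
  exists (mkposreal d Hd); intros y Hyd; exact (Hy y Hyd).
Qed.

Lemma has_cderiv_const (c z : C) : has_cderiv (fun _ => c) z (RtoC 0).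
Proof. exact (is_derive_const c z). Qed.

Lemma has_cderiv_id (z : C) : has_cderiv (fun y => y) z (RtoC 1).
Proof. apply has_cderiv_AbsRing; exact (is_derive_id z). Qed.

Lemma has_cderiv_plus (f g : C -> C) (z a b : C) :
  has_cderiv f z a -> has_cderiv g z b ->
  has_cderiv (fun y => Cplus (f y) (g y)) z (Cplus a b).
Proof. intros Hf Hg; exact (is_derive_plus f g z a b Hf Hg). Qed.

Lemma has_cderiv_mult (f g : C -> C) (z a b : C) :
  has_cderiv f z a -> has_cderiv g z b ->
  has_cderiv (fun y => Cmult (f y) (g y)) z (Cplus (Cmult a (g z)) (Cmult (f z) b)).
Proof.
intros Hf Hg; apply has_cderiv_AbsRing.
apply (is_derive_mult (K := C_AbsRing) f g z a b);
  [now apply has_cderiv_AbsRing | now apply has_cderiv_AbsRing | exact Cmult_comm].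
Qed.

Lemma has_cderiv_comp (f g : C -> C) (z a b : C) :
  has_cderiv f (g z) a -> has_cderiv g z b ->
  has_cderiv (fun y => f (g y)) z (Cmult b a).
Proof.
intros Hf Hg.
exact (is_derive_comp (K := C_AbsRing) f g z a b Hf (proj1 (has_cderiv_AbsRing _ _ _) Hg)).
Qed.

Lemma has_cderiv_inv (z : C) : z <> RtoC 0 ->
  has_cderiv Cinv z (- / (z * z))%C.
Proof.
intros Hz; apply has_cderiv_eps; intros eps Heps.
assert (Hm : 0 < Cmod z) by now apply Cmod_gt_0.
set (m := Cmod z) in *.
assert (Hm3 : 0 < m * m * m) by (repeat apply Rmult_lt_0_compat; lra).
assert (He3 : 0 < eps * (m * m * m) / 2).
{ apply Rdiv_lt_0_compat; [now apply Rmult_lt_0_compat | lra]. }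
(* The remainder is (y - z)^2 / (y z^2). The first bound keeps |y| > |z| / 2, and then the second
   gives |y - z| / (|y| |z|^2) <= eps. *)
exists (Rmin (m / 2) (eps * (m * m * m) / 2)); split.
{ apply Rmin_pos; [lra | exact He3]. }
intros y Hy.
assert (Hy1 := Rlt_le_trans _ _ _ Hy (Rmin_l _ _)).
assert (Hy2 := Rlt_le_trans _ _ _ Hy (Rmin_r _ _)).
assert (Hym : m / 2 < Cmod y).
{ assert (T := Cmod_triangle y (- (y - z))%C).
  replace (y + - (y - z))%C with z in T by ring.
  rewrite Cmod_opp in T; fold m in T; lra. }
assert (Hy0 : y <> RtoC 0) by (apply Cmod_gt_0; lra).
replace (/ y - / z - (y - z) * (- / (z * z)))%C
  with ((y - z) * ((y - z) * / (y * (z * z))))%C by (field; split; assumption).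
rewrite !Cmod_mult, Cmod_inv by now repeat apply Cmult_neq_0.
rewrite !Cmod_mult; fold m.
rewrite Rmult_comm; apply Rmult_le_compat_r; [apply Cmod_ge_0|].
assert (Hmm : 0 < m * m) by (apply Rmult_lt_0_compat; lra).
assert (Hp : m * m * m / 2 <= Cmod y * (m * m)) by nra.
apply Rmult_le_reg_r with (Cmod y * (m * m)); [lra|].
rewrite Rmult_assoc, Rinv_l by lra.
nra.
Qed.

(** * Continuity and differentiation along rays *)

Lemma has_cderiv_continuous (f : C -> C) (z l : C) :
  has_cderiv f z l ->
  filterlim f (locally (T := AbsRing_UniformSpace C_AbsRing) z)
    (locally (T := C_UniformSpace) (f z)).
Proof.
intros H; apply (ex_derive_continuous (K := C_AbsRing) (V := C_NormedModule)).
exists l; exact H.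
Qed.

Lemma continuous_ray (f : C -> C) (w : C) (t : R) (l : C) :
  has_cderiv f (RtoC t * w)%C l ->
  continuous (U := C_UniformSpace) (fun s : R => f (RtoC s * w)%C) t.
Proof.
intros H.
apply (filterlim_comp _ _ _ (fun s : R => RtoC s * w)%C f _
  (locally (T := AbsRing_UniformSpace C_AbsRing) (RtoC t * w)%C)).
2: exact (has_cderiv_continuous _ _ _ H).
apply (filterlim_locally (F := locally t) (U := AbsRing_UniformSpace C_AbsRing)); intros eps.
(* Adding 1 to |w| keeps the radius meaningful when w = 0. *)
assert (Hp : 0 < eps / (Cmod w + 1)).
{ apply Rdiv_lt_0_compat; [apply cond_pos | assert (T := Cmod_ge_0 w); lra]. }
exists (mkposreal _ Hp); intros s Hs.
change (Rabs (s - t) < eps / (Cmod w + 1)) in Hs.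
change (Cmod (RtoC s * w - RtoC t * w)%C < eps).
replace (RtoC s * w - RtoC t * w)%C with (RtoC (s - t) * w)%C
  by (rewrite RtoC_minus; ring).
rewrite Cmod_mult, Cmod_R.
assert (T := Cmod_ge_0 w); assert (T2 := Rabs_pos (s - t)).
apply Rmult_lt_compat_r with (r := Cmod w + 1) in Hs; [|lra].
unfold Rdiv in Hs; rewrite Rmult_assoc, Rinv_l in Hs by lra.
nra.
Qed.

(** The real remainder is the imaginary part of the complex remainder D at s w, and |Im D| <=
    |D|. *)
Lemma is_derive_ray_im (f : C -> C) (w : C) (t : R) (l : C) :
  has_cderiv f (RtoC t * w)%C l ->
  is_derive (fun s : R => snd (f (RtoC s * w)%C)) t (snd (w * l)%C).
Proof.
intros H.
split; [apply is_linear_scal_l|].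
intros x Hx eps.
rewrite <- (is_filter_lim_locally_unique (V := AbsRing_NormedModule R_AbsRing) _ _ Hx); clear x Hx.
assert (Hw := Cmod_ge_0 w).
assert (Hp : 0 < eps / (Cmod w + 1)).
{ apply Rdiv_lt_0_compat; [apply cond_pos | lra]. }
destruct (proj1 (has_cderiv_eps _ _ _) H _ Hp) as [d [Hd Hy]].
assert (Hp' : 0 < d / (Cmod w + 1)).
{ apply Rdiv_lt_0_compat; lra. }
exists (mkposreal _ Hp'); intros s Hs.
change (Rabs (s - t) < d / (Cmod w + 1)) in Hs.
assert (T2 := Rabs_pos (s - t)).
apply Rmult_lt_compat_r with (r := Cmod w + 1) in Hs; [|lra].
unfold Rdiv in Hs; rewrite Rmult_assoc, Rinv_l in Hs by lra.
assert (E : (RtoC s * w - RtoC t * w)%C = (RtoC (s - t) * w)%C)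
  by (rewrite RtoC_minus; ring).
specialize (Hy (RtoC s * w)%C); rewrite E, Cmod_mult, Cmod_R in Hy.
assert (Hlt : Rabs (s - t) * Cmod w < d) by nra.
specialize (Hy Hlt).
change (Rabs (snd (f (RtoC s * w)%C) - snd (f (RtoC t * w)%C) - (s - t) * snd (w * l)%C)
  <= eps * Rabs (s - t)).
set (D := (f (RtoC s * w) - f (RtoC t * w) - RtoC (s - t) * w * l)%C) in Hy.
replace (snd (f (RtoC s * w)%C) - snd (f (RtoC t * w)%C) - (s - t) * snd (w * l)%C)
  with (snd D) by (unfold D; simpl; ring).
apply Rle_trans with (Cmod D).
{ eapply Rle_trans; [apply Rmax_r | apply Rmax_Cmod]. }
eapply Rle_trans; [exact Hy|].
assert (He := cond_pos eps).
apply Rmult_le_reg_r with (Cmod w + 1); [lra|].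
replace (eps / (Cmod w + 1) * (Rabs (s - t) * Cmod w) * (Cmod w + 1))
  with (eps * (Rabs (s - t) * Cmod w)) by (field; lra).
assert (0 <= eps * Rabs (s - t)) by (apply Rmult_le_pos; lra).
nra.
Qed.

Lemma continuous_pair (a b : R -> R) (t : R) :
  continuous a t -> continuous b t ->
  continuous (U := C_UniformSpace) (fun s => (a s, b s)) t.
Proof.
intros Ha Hb; apply (filterlim_comp_2 (F := locally t) _ _ pair Ha Hb).
intros P [eps H].
exists (fun x => ball (a t) eps x) (fun y => ball (b t) eps y);
 [now exists eps | now exists eps |].
intros x y Hx Hy; apply H; now split.
Qed.

Lemma continuous_Cmult (f g : R -> C) (t : R) :
  continuous (U := C_UniformSpace) f t -> continuous (U := C_UniformSpace) g t ->
  continuous (U := C_UniformSpace) (fun s => (f s * g s)%C) t.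
Proof.
intros Hf Hg.
assert (Hf1 : continuous (fun s => fst (f s)) t)
  by (apply (continuous_comp f fst); [exact Hf | apply continuous_fst]).
assert (Hf2 : continuous (fun s => snd (f s)) t)
  by (apply (continuous_comp f snd); [exact Hf | apply continuous_snd]).
assert (Hg1 : continuous (fun s => fst (g s)) t)
  by (apply (continuous_comp g fst); [exact Hg | apply continuous_fst]).
assert (Hg2 : continuous (fun s => snd (g s)) t)
  by (apply (continuous_comp g snd); [exact Hg | apply continuous_snd]).
apply continuous_pair.
- apply (continuous_minus (fun s => fst (f s) * fst (g s)) (fun s => snd (f s) * snd (g s)));
  now apply (continuous_mult (K := R_AbsRing)).
- apply (continuous_plus (fun s => fst (f s) * snd (g s)) (fun s => snd (f s) * fst (g s)));
  now apply (continuous_mult (K := R_AbsRing)).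
Qed.

Lemma continuous_Cmod (f : R -> C) (t : R) :
  continuous (U := C_UniformSpace) f t -> continuous (fun s => Cmod (f s)) t.
Proof.
intros Hf; apply (continuous_comp f Cmod); [exact Hf|].
exact (filterlim_norm (K := C_AbsRing) (V := C_NormedModule) (f t)).
Qed.

Lemma continuous_cexp (f : R -> C) (t : R) :
  continuous (U := C_UniformSpace) f t ->
  continuous (U := C_UniformSpace) (fun s => cexp (f s)) t.
Proof.
intros Hf.
assert (Hf1 : continuous (fun s => fst (f s)) t)
  by (apply (continuous_comp f fst); [exact Hf | apply continuous_fst]).
assert (Hf2 : continuous (fun s => snd (f s)) t)
  by (apply (continuous_comp f snd); [exact Hf | apply continuous_snd]).
apply continuous_pair; apply (continuous_mult (K := R_AbsRing)).
- now apply continuous_exp_comp.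
- now apply continuous_cos_comp.
- now apply continuous_exp_comp.
- now apply continuous_sin_comp.
Qed.

(** * Real inequalities for the cosine sum *)

(** Up to the factor 1 - q this is a Riemann sum of s / (s^2 + p^2) over p in (0, 1] with nodes q^j,
    hence bounded uniformly in s and n. Both the size of the test function and the error terms are
    controlled by it independently of J. *)
Lemma sum_geometric_kernel (q s : R) (n : nat) : 0 < q < 1 -> 0 < s ->
  sum_f_R0 (fun j => s * q ^ j / (s ^ 2 + (q ^ j) ^ 2)) n <= 2 / (1 - q).
Proof.
intros Hq Hs.
assert (Hpos : forall j, 0 < q ^ j) by (intros j; apply pow_lt; lra).
(* Telescoping: (1-q)/2 sp/(s^2+p^2) <= p/(s+p) - qp/(s+qp) with p = q^j. *)
assert (Hstep : forall j, (1 - q) / 2 * (s * q ^ j / (s ^ 2 + (q ^ j) ^ 2))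
   <= q ^ j / (s + q ^ j) - q ^ S j / (s + q ^ S j)).
{ intros j; simpl (q ^ S j); assert (Hp := Hpos j).
  set (p := q ^ j) in *.
  assert (Hqp : 0 < q * p <= p) by (split; [apply Rmult_lt_0_compat|]; nra).
  assert (Hsp : 0 < s * p) by (apply Rmult_lt_0_compat; lra).
  replace (p / (s + p) - q * p / (s + q * p))
    with ((1 - q) * (s * p) * / ((s + p) * (s + q * p))) by (field; lra).
  replace ((1 - q) / 2 * (s * p / (s ^ 2 + p ^ 2)))
    with ((1 - q) * (s * p) * / (2 * (s ^ 2 + p ^ 2))) by (field; nra).
  apply Rmult_le_compat_l; [nra|].
  apply Rinv_le_contravar; [apply Rmult_lt_0_compat; lra|].
  apply Rle_trans with ((s + p) * (s + p)); [apply Rmult_le_compat_l; lra|].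
  assert (H := pow2_ge_0 (s - p)); lra. }
assert (Hsum : (1 - q) / 2 * sum_f_R0 (fun j => s * q ^ j / (s ^ 2 + (q ^ j) ^ 2)) n
   <= 1 / (s + 1) - q ^ S n / (s + q ^ S n)).
{ induction n as [|n IH].
  - apply (Hstep 0%nat).
  - rewrite tech5, Rmult_plus_distr_l; assert (H := Hstep (S n)); lra. }
assert (Hlast : 0 < q ^ S n / (s + q ^ S n)).
{ assert (H := Hpos (S n)); apply Rdiv_lt_0_compat; lra. }
assert (Hfirst : 1 / (s + 1) <= 1).
{ apply Rmult_le_reg_r with (s + 1); [lra|]; field_simplify; lra. }
apply Rmult_le_reg_l with ((1 - q) / 2); [lra|].
replace ((1 - q) / 2 * (2 / (1 - q))) with 1 by (field; lra); lra.
Qed.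

(** For t <= s, ln x <= x - 1 gives (ln s - ln t) s t <= s (s - t) <= s^2 - t^2. Squaring this at s
    = sqrt u, t = sqrt v (or the reverse), where the logarithms are halved, yields the factor 4. *)
Lemma sqr_ln_diff_le (u v : R) : 0 < u -> 0 < v ->
  (ln u - ln v) ^ 2 * (u * v) <= 4 * (u - v) ^ 2.
Proof.
assert (Hord : forall s t, 0 < t -> t <= s ->
  0 <= (ln s - ln t) * (s * t) <= s ^ 2 - t ^ 2).
{ intros s t Ht Hts.
  assert (H0 : 0 <= ln s - ln t).
  { destruct (Rle_lt_or_eq_dec t s Hts) as [H|H]; [|subst; lra].
    assert (L := ln_increasing t s Ht H); lra. }
  assert (H1 : ln s - ln t <= s / t - 1).
  { assert (E := exp_ineq1_le (ln s - ln t)).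
    unfold Rminus in E; rewrite exp_plus, exp_Ropp, !exp_ln in E by lra.
    unfold Rdiv; lra. }
  assert (Hst : 0 < s * t) by (apply Rmult_lt_0_compat; lra).
  split; [apply Rmult_le_pos; lra|].
  apply Rle_trans with ((s / t - 1) * (s * t)).
  - apply Rmult_le_compat_r; lra.
  - replace ((s / t - 1) * (s * t)) with (s * (s - t)) by (field; lra); nra. }
intros Hu Hv.
assert (Hsu := sqrt_lt_R0 u Hu); assert (Hsv := sqrt_lt_R0 v Hv).
assert (Eu := sqrt_sqrt u (Rlt_le _ _ Hu)); assert (Ev := sqrt_sqrt v (Rlt_le _ _ Hv)).
set (s := sqrt u) in *; set (t := sqrt v) in *.
rewrite <- Eu, <- Ev, !ln_mult by assumption.
destruct (Rle_or_lt t s) as [H|H].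
- assert (H2 := Hord s t Hsv H).
  assert (H3 := pow_incr _ _ 2 H2); nra.
- assert (H2 := Hord t s Hsu (Rlt_le _ _ H)).
  assert (H3 := pow_incr _ _ 2 H2); nra.
Qed.

(** By the half-angle formula cos y = 1 - 2 sin^2 (y/2), this is |sin x| <= |x|. *)
Lemma cos_ge_quadratic (y : R) : 1 - y ^ 2 / 2 <= cos y.
Proof.
replace y with (2 * (y / 2)) at 2 by field.
rewrite cos_2a_sin.
assert (H : sin (y / 2) ^ 2 <= (y / 2) ^ 2).
{ assert (Hp : forall x, 0 <= x -> Rabs (sin x) <= Rabs x).
  { intros x Hx; rewrite (Rabs_pos_eq x) by assumption.
    destruct (Req_dec x 0) as [->|Hx0]; [rewrite sin_0, Rabs_R0; lra|].
    apply Rabs_le; split; [|apply Rlt_le, sin_lt_x; lra].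
    destruct (Rle_or_lt x PI) as [HP|HP].
    - assert (S := sin_ge_0 x Hx HP); lra.
    - assert (S := SIN_bound x); assert (P := PI2_1); lra. }
  rewrite <- !Rsqr_pow2; apply Rsqr_le_abs_1.
  destruct (Rle_or_lt 0 (y / 2)) as [H|H]; [now apply Hp|].
  rewrite <- (Rabs_Ropp (sin _)), <- sin_neg, <- (Rabs_Ropp (y / 2)).
  apply Hp; lra. }
nra.
Qed.

(** For a kernel value X, the left side will dominate the loss due to the phase error, and the right
    side is a loss the cosine sum can afford. If B (1 - X) <= X / 2, the first term on the right
    suffices. Otherwise X (1 + 1/(2B)) < 1, so X^n decays geometrically and the second term suffices
    for large n. *)
Lemma power_gap (B : R) : 0 < B -> exists n : nat, forall X : R, 0 <= X <= 1 ->
  B * (X ^ n - X ^ S n) <= X ^ S n / 2 + X / (128 * INR (S n)).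
Proof.
intros HB.
destruct (archimed (2048 * B ^ 3)) as [Hup _].
assert (HB3 : 0 < B ^ 3) by (apply pow_lt; lra).
(* Below, Bernoulli gives m X^m <= 2 B, hence B X^(2m) <= 4 B^3 / m^2. This is at most 1 / (512 m)
   once m >= 2048 B^3, and 128 N <= 512 m because N = 2 m + 2 <= 4 m. *)
set (m := Z.to_nat (up (2048 * B ^ 3))).
assert (Hm : 2048 * B ^ 3 < INR m).
{ unfold m; rewrite INR_IZR_INZ, Z2Nat.id; [lra|].
  apply le_IZR; lra. }
assert (Hm1 : 1 <= INR m).
{ apply (le_INR 1); destruct m; [simpl in Hm; lra | lia]. }
(* One factor X is set aside to match the X on the right; the other 2 m form the square of X^m. *)
exists (S (2 * m)); intros X HX.
set (N := INR (S (S (2 * m)))).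
assert (HN : N = 2 * INR m + 2).
{ unfold N; rewrite !S_INR, mult_INR; simpl; lra. }
assert (HXS : 0 <= X ^ S (2 * m)) by (apply pow_le; lra).
assert (HXN : 0 <= X / (128 * N)).
{ apply Rmult_le_pos; [lra | apply Rlt_le, Rinv_0_lt_compat; lra]. }
change (X ^ S (S (2 * m))) with (X * X ^ S (2 * m)).
destruct (Rle_or_lt (B * (1 - X)) (X / 2)) as [Hc|Hc]; [nra|].
assert (Hkey : B * X ^ (2 * m) <= / (128 * N)).
{ assert (Hpow : X ^ m * (1 + INR m * / (2 * B)) <= 1).
  { assert (Hb : 1 + INR m * / (2 * B) <= (1 + / (2 * B)) ^ m).
    { apply poly, Rinv_0_lt_compat; lra. }
    assert (Hx1 : (X * (1 + / (2 * B))) ^ m <= 1).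
    { apply Rle_trans with (1 ^ m); [apply pow_incr | rewrite pow1; lra].
      assert (Hi : 0 < / (2 * B)) by (apply Rinv_0_lt_compat; lra).
      assert (Hi2 : B * / (2 * B) = / 2) by (field; lra).
      assert (Hi3 : X * (1 + / (2 * B)) * (2 * B) = 2 * B * X + X) by (field; lra).
      set (i := / (2 * B)) in *.
      split; [apply Rmult_le_pos; lra|].
      apply Rmult_le_reg_r with (2 * B); [lra|].
      rewrite Hi3; lra. }
    rewrite Rpow_mult_distr in Hx1.
    assert (0 <= X ^ m) by (apply pow_le; lra).
    eapply Rle_trans; [|exact Hx1]; now apply Rmult_le_compat_l. }
  assert (Hx0 : 0 <= X ^ m) by (apply pow_le; lra).
  assert (Hxm : X ^ m * INR m <= 2 * B).
  { apply Rmult_le_compat_l with (r := 2 * B) in Hpow; [|lra].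
    replace (2 * B * (X ^ m * (1 + INR m * / (2 * B))))
      with (2 * B * X ^ m + X ^ m * INR m) in Hpow by (field; lra).
    nra. }
  assert (Hsq : (X ^ m * INR m) ^ 2 <= (2 * B) ^ 2).
  { apply pow_incr; split; [apply Rmult_le_pos; lra | exact Hxm]. }
  replace (2 * m)%nat with (m + m)%nat by lia; rewrite pow_add.
  apply Rmult_le_reg_r with (128 * N); [lra|]; rewrite Rinv_l by lra.
  set (Y := X ^ m) in *; set (k := INR m) in *.
  assert (HY : 0 <= Y * Y) by nra.
  apply Rle_trans with (B * (Y * Y) * (512 * k)).
  { apply Rmult_le_compat_l; [apply Rmult_le_pos|]; lra. }
  apply Rmult_le_reg_r with k; [lra|].
  apply Rle_trans with (512 * B * (2 * B) ^ 2); [|nra].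
  replace (B * (Y * Y) * (512 * k) * k) with (512 * B * (Y * k) ^ 2) by ring.
  apply Rmult_le_compat_l; lra. }
change (X ^ S (2 * m)) with (X * X ^ (2 * m)) in *.
assert (H1 : B * (X * X ^ (2 * m)) <= X / (128 * N)).
{ replace (B * (X * X ^ (2 * m))) with (X * (B * X ^ (2 * m))) by ring.
  now apply Rmult_le_compat_l. }
nra.
Qed.

Lemma geometric_bracket (q u : R) (n : nat) : 0 < q < 1 -> q ^ n <= u <= 1 ->
  exists j, (j <= n)%nat /\ q * q ^ j <= u <= q ^ j.
Proof.
intros Hq; induction n as [|n IH]; intros Hu.
- exists 0%nat; simpl in *; split; [lia | lra].
- destruct (Rle_or_lt (q ^ n) u) as [H|H].
  + destruct IH as [j [Hj Hj2]]; [lra|]; exists j; split; [lia | exact Hj2].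
  + exists n; simpl in Hu; split; [lia | lra].
Qed.

Lemma sum_f_R0_ge_term (f : nat -> R) (n j : nat) :
  (forall i, 0 <= f i) -> (j <= n)%nat -> f j <= sum_f_R0 f n.
Proof.
intros Hf; induction n as [|n IH]; intros Hj.
- replace j with 0%nat by lia; simpl; lra.
- rewrite tech5; destruct (Nat.eq_dec j (S n)) as [->|Hn].
  + assert (H := cond_pos_sum f n Hf); lra.
  + assert (H1 := Hf (S n)); assert (H2 : f j <= sum_f_R0 f n) by (apply IH; lia); lra.
Qed.

(** Both upper bounds come from the denominator: (u + v)^2 >= 4 u v and (u + v)^2 >= u^2 + v^2. The
    second puts the kernel under [sum_geometric_kernel]. *)
Lemma kernel_bounds (u v : R) : 0 < u -> 0 < v ->
  0 < 4 * (u * v) / (u + v) ^ 2 <= 1 /\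
  4 * (u * v) / (u + v) ^ 2 <= 4 * (u * v / (u ^ 2 + v ^ 2)).
Proof.
intros Hu Hv.
assert (Huv : 0 < u * v) by (apply Rmult_lt_0_compat; lra).
split; [split|].
- apply Rdiv_lt_0_compat; nra.
- apply Rmult_le_reg_r with ((u + v) ^ 2); [nra|].
  unfold Rdiv; rewrite Rmult_assoc, Rinv_l by (apply pow_nonzero; lra).
  assert (H := pow2_ge_0 (u - v)); lra.
- unfold Rdiv; rewrite Rmult_assoc; apply Rmult_le_compat_l; [lra|].
  apply Rmult_le_compat_l; [lra|].
  apply Rinv_le_contravar; nra.
Qed.

(** Write N = [S n], X for a kernel value and d for the phase error. Since cos d >= 1 - d^2/2,
    [power_gap] bounds each term below by X^N / 2 - X / (128 N). The node next to u alone
    contributes at least 1/4 to the first part, and the second part sums to at most 1/8. *)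
Lemma sum_cos_lower_bound (M : R) : 0 <= M -> exists n : nat,
  forall (u alpha : R) (beta : nat -> R) (J : nat),
  let q := 1 - / (2 * INR (S n)) in
  q ^ J <= u <= 1 ->
  (forall j, (alpha - beta j) ^ 2 <= M ^ 2 * (ln u - ln (q ^ j)) ^ 2) ->
  1 / 8 <= sum_f_R0 (fun j => (4 * (u * q ^ j) / (u + q ^ j) ^ 2) ^ S n
                              * cos (alpha - beta j)) J.
Proof.
intros HM.
(* The constant 8 M^2 is the one in [Hy] below; the added 1 makes it positive when M = 0. *)
destruct (power_gap (8 * M ^ 2 + 1)) as [n Hn]; [nra|].
exists n; intros u alpha beta J q Hu Hab.
assert (HN : 1 <= INR (S n)) by (apply (le_INR 1); lia).
set (N := INR (S n)) in *.
assert (Hi : 0 < / (2 * N) <= / 2).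
{ split; [apply Rinv_0_lt_compat | apply Rinv_le_contravar]; lra. }
assert (Hq : 0 < q < 1) by (unfold q; lra).
assert (Hqj : forall j, 0 < q ^ j) by (intros j; apply pow_lt; lra).
assert (Hu0 : 0 < u) by (assert (H := Hqj J); lra).
set (X := fun j => 4 * (u * q ^ j) / (u + q ^ j) ^ 2).
assert (HX : forall j, 0 < X j <= 1) by (intros j; now apply kernel_bounds).
assert (Hterm : forall j, X j ^ S n * / 2 - X j * / (128 * N)
   <= X j ^ S n * cos (alpha - beta j)).
{ intros j.
  assert (HXj := HX j).
  assert (HXn : 0 < X j ^ n) by (apply pow_lt; lra).
  (* Since 1 - X j = ((u - q^j) / (u + q^j))^2, [sqr_ln_diff_le] turns the squared logarithmic
     distance into the gap 1 - X j. *)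
  assert (Hy : (alpha - beta j) ^ 2 / 2 * X j <= 8 * M ^ 2 * (1 - X j)).
  { apply Rle_trans with (M ^ 2 * (ln u - ln (q ^ j)) ^ 2 / 2 * X j).
    { apply Rmult_le_compat_r; [lra|]; assert (H := Hab j); lra. }
    assert (L := sqr_ln_diff_le u (q ^ j) Hu0 (Hqj j)).
    assert (Hp := Hqj j).
    assert (E : 1 - X j = (u - q ^ j) ^ 2 * / (u + q ^ j) ^ 2)
      by (unfold X; field; lra).
    rewrite E; unfold X.
    assert (Hinv : 0 < / (u + q ^ j) ^ 2) by (apply Rinv_0_lt_compat; nra).
    replace (M ^ 2 * (ln u - ln (q ^ j)) ^ 2 / 2 * (4 * (u * q ^ j) / (u + q ^ j) ^ 2))
      with (2 * M ^ 2 * / (u + q ^ j) ^ 2 * ((ln u - ln (q ^ j)) ^ 2 * (u * q ^ j)))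
      by (field; lra).
    replace (8 * M ^ 2 * ((u - q ^ j) ^ 2 * / (u + q ^ j) ^ 2))
      with (2 * M ^ 2 * / (u + q ^ j) ^ 2 * (4 * (u - q ^ j) ^ 2)) by ring.
    apply Rmult_le_compat_l; [|exact L].
    apply Rmult_le_pos; nra. }
  assert (Hc := cos_ge_quadratic (alpha - beta j)).
  assert (Hg := Hn (X j) (conj (Rlt_le _ _ (proj1 HXj)) (proj2 HXj))).
  simpl in Hg |- *; fold N in Hg; unfold Rdiv in Hg.
  set (c := cos (alpha - beta j)) in *; set (d := (alpha - beta j) ^ 2 / 2) in *.
  assert (H1 : X j * X j ^ n * (1 - d) <= X j * X j ^ n * c).
  { apply Rmult_le_compat_l; [apply Rmult_le_pos; lra | exact Hc]. }
  assert (H2 : X j ^ n * (d * X j) <= X j ^ n * (8 * M ^ 2 * (1 - X j))).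
  { apply Rmult_le_compat_l; lra. }
  assert (H3 : 0 <= X j ^ n * (1 - X j)) by (apply Rmult_le_pos; lra).
  nra. }
apply Rle_trans with (sum_f_R0 (fun j => X j ^ S n * / 2 - X j * / (128 * N)) J);
  [|apply sum_Rle; intros; apply Hterm].
rewrite minus_sum, <- !scal_sum.
(* Here 1 - q = 1 / (2 N), so the bound 4 * 2 / (1 - q) is 16 N; divided by 128 N it costs exactly
   1/8. *)
assert (HS : sum_f_R0 X J <= 16 * N).
{ apply Rle_trans with (sum_f_R0 (fun j => (u * q ^ j / (u ^ 2 + (q ^ j) ^ 2)) * 4) J).
  - apply sum_Rle; intros j _; rewrite Rmult_comm; now apply kernel_bounds.
  - rewrite <- scal_sum; assert (H := sum_geometric_kernel q u J Hq Hu0).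
    replace (2 / (1 - q)) with (4 * N) in H by (unfold q; field; lra); lra. }
(* At the node with q q^j <= u <= q^j, X j >= u / q^j >= q. Bernoulli then gives q^N >= 1 - N (1 -
   q) = 1/2, which is the reason for the choice of q. *)
assert (HL : / 2 <= sum_f_R0 (fun j => X j ^ S n) J).
{ destruct (geometric_bracket q u J Hq Hu) as [j [HjJ Hj]].
  apply Rle_trans with (X j ^ S n);
    [|apply (sum_f_R0_ge_term (fun j => X j ^ S n)); [intros i; apply pow_le; apply Rlt_le, HX | exact HjJ]].
  assert (HXq : q <= X j).
  { unfold X; assert (Hp := Hqj j).
    apply Rmult_le_reg_r with ((u + q ^ j) ^ 2); [nra|].
    unfold Rdiv; rewrite Rmult_assoc, Rinv_l by (apply pow_nonzero; lra).
    assert (H4 : q * (u + q ^ j) ^ 2 <= q * (q ^ j * q ^ j * 4)).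
    { apply Rmult_le_compat_l; nra. }
    assert (H5 : q * q ^ j * q ^ j <= u * q ^ j) by (apply Rmult_le_compat_r; lra).
    nra. }
  apply Rle_trans with (q ^ S n); [|apply pow_incr; lra].
  assert (Hb : forall k, 1 - INR k * / (2 * N) <= q ^ k).
  { induction k as [|k IH]; [simpl; lra|].
    rewrite S_INR; simpl (q ^ S k); unfold q at 1.
    assert (Hk := pos_INR k).
    assert (0 <= INR k * / (2 * N)) by (apply Rmult_le_pos; lra).
    nra. }
  specialize (Hb (S n)); fold N in Hb.
  replace (N * / (2 * N)) with (/ 2) in Hb by (field; lra); lra. }
assert (H6 : / (128 * N) * sum_f_R0 X J <= / (128 * N) * (16 * N)).
{ apply Rmult_le_compat_l; [apply Rlt_le, Rinv_0_lt_compat; lra | exact HS]. }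
replace (/ (128 * N) * (16 * N)) with (/ 8) in H6 by (field; lra).
lra.
Qed.

(** * The unit circle, the exponential and polar form *)

Lemma Cmod_eitheta (t : R) : Cmod (eitheta t) = 1.
Proof.
unfold Cmod, eitheta; simpl fst; simpl snd.
rewrite <- !Rsqr_pow2, Rplus_comm, sin2_cos2; apply sqrt_1.
Qed.

Lemma eitheta_plus (s t : R) : eitheta (s + t) = (eitheta s * eitheta t)%C.
Proof.
unfold eitheta, Cmult; simpl; rewrite cos_plus, sin_plus; f_equal; ring.
Qed.

Lemma eitheta_opp_l (t : R) : (eitheta (- t) * eitheta t)%C = RtoC 1.
Proof.
rewrite <- eitheta_plus, Rplus_opp_l; unfold eitheta; now rewrite cos_0, sin_0.
Qed.

Lemma cexp_polar (z : C) : cexp z = (RtoC (exp (fst z)) * eitheta (snd z))%C.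
Proof. unfold cexp, eitheta, RtoC, Cmult; simpl; f_equal; ring. Qed.

Lemma Cmod_cexp (z : C) : Cmod (cexp z) = exp (fst z).
Proof.
rewrite cexp_polar, Cmod_mult, Cmod_eitheta, Cmod_R, Rabs_pos_eq; [ring|].
apply Rlt_le, exp_pos.
Qed.

Lemma norm_C_R (z : C) : norm (V := C_R_NormedModule) z = Cmod z.
Proof.
change (sqrt (Rabs (fst z) ^ 2 + Rabs (snd z) ^ 2) = Cmod z).
unfold Cmod; now rewrite !pow2_abs.
Qed.

Lemma polar_form (z : C) : exists theta : R,
  0 <= theta < 2 * PI /\ z = (RtoC (Cmod z) * eitheta theta)%C.
Proof.
destruct (Req_dec (Cmod z) 0) as [H0|H0].
{ exists 0; split; [assert (P := PI_RGT_0); lra|].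
  rewrite (Cmod_eq_0 z H0), Cmod_0; ring. }
destruct z as [x y].
set (m := Cmod (x, y)) in *.
assert (Hm : 0 < m) by (assert (H := Cmod_ge_0 (x, y)); fold m in H; lra).
assert (Hm2 : m * m = x * x + y * y).
{ unfold m, Cmod; simpl fst; simpl snd; rewrite sqrt_sqrt; nra. }
assert (Hx : -1 <= x / m <= 1).
{ assert (Hxm : x / m * m = x) by (field; lra).
  assert (Hab : - m <= x <= m) by (split; nra).
  split; apply Rmult_le_reg_r with m; lra. }
assert (Hs : sqrt (1 - (x / m)²) = Rabs y / m).
{ replace (1 - (x / m)²) with ((y / m)²).
  - rewrite sqrt_Rsqr_abs, Rabs_div, (Rabs_pos_eq m) by lra; reflexivity.
  - unfold Rsqr; replace (y / m * (y / m)) with ((y * y) / (m * m)) by (field; lra).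
    replace (y * y) with (m * m - x * x) by lra; field; lra. }
assert (Ha := acos_bound (x / m)).
destruct (Rle_or_lt 0 y) as [Hy|Hy].
- exists (acos (x / m)); split; [assert (P := PI_RGT_0); lra|].
  unfold eitheta; rewrite cos_acos, sin_acos, Hs, Rabs_pos_eq by lra.
  unfold RtoC, Cmult; simpl; f_equal; field; lra.
- exists (2 * PI - acos (x / m)); split.
  + split; [lra|].
    (* A zero arccosine would put the angle at 2 PI, outside the half-open range; it forces x = m,
       hence y = 0, against y < 0. *)
    destruct (Req_dec (acos (x / m)) 0) as [E|E]; [|lra].
    assert (E1 := cos_acos _ Hx); rewrite E, cos_0 in E1.
    assert (E2 : x = m) by (rewrite <- (Rmult_1_l m), E1; field; lra).
    nra.
  + unfold eitheta.
    rewrite cos_minus, sin_minus, cos_2PI, sin_2PI, cos_acos, sin_acos, Hs by lra.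
    rewrite Rabs_left by lra.
    unfold RtoC, Cmult; simpl; f_equal; field; lra.
Qed.

(** * The kernels and the test sum *)

(** With u = 1 - z this is 4 u v / (u + v)^2 = 1 - ((u - v) / (u + v))^2: a bump on the half-plane
    Re u > 0, equal to 1 at u = v. *)
Definition ray_kernel (v : R) (z : C) : C :=
  (RtoC (4 * v) * (1 - z) * / ((1 - z + RtoC v) * (1 - z + RtoC v)))%C.

Definition phase_sum (n : nat) (q : R) (beta : nat -> R) (J : nat) (z : C) : C :=
  sum_n (G := C_AbelianMonoid)
    (fun j => (eitheta (- beta j) * ray_kernel (q ^ j) z ^ S n)%C) J.

Lemma disk_fst_lt_1 (z : C) : in_disk z -> fst z < 1.
Proof.
intros Hz; assert (H := re_le_Cmod z); apply Rabs_le_between in H.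
unfold in_disk, Re in *; lra.
Qed.

Lemma ray_kernel_denominator (v : R) (z : C) : in_disk z -> 0 < v ->
  (1 - z + RtoC v)%C <> RtoC 0.
Proof.
intros Hz Hv E; apply (f_equal fst) in E; simpl in E.
assert (H := disk_fst_lt_1 z Hz); lra.
Qed.

Lemma ray_kernel_derivable (v : R) (z : C) : in_disk z -> 0 < v ->
  exists l, has_cderiv (ray_kernel v) z l.
Proof.
intros Hz Hv.
assert (Hu : exists l, has_cderiv (fun y => 1 - y)%C z l).
{ eexists; apply (has_cderiv_plus (fun _ => RtoC 1) (fun y => - y)%C);
    [apply has_cderiv_const|].
  apply (is_derive_ext (K := C_AbsRing) (V := C_NormedModule) (fun y : C => (RtoC (-1) * y)%C)).
  { intros y; unfold RtoC, Cmult, Copp; simpl; f_equal; ring. }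
  apply (has_cderiv_mult (fun _ => RtoC (-1)) (fun y => y));
    [apply has_cderiv_const | apply has_cderiv_id]. }
destruct Hu as [l1 H1].
assert (H2 := has_cderiv_plus _ _ z _ _ H1 (has_cderiv_const (RtoC v) z)).
assert (Hden := ray_kernel_denominator v z Hz Hv).
eexists; apply has_cderiv_mult.
- apply has_cderiv_mult; [apply has_cderiv_const | exact H1].
- apply (has_cderiv_comp Cinv).
  + apply has_cderiv_inv, Cmult_neq_0; assumption.
  + apply has_cderiv_mult; exact H2.
Qed.

Lemma has_cderiv_pow (f : C -> C) (z l : C) (n : nat) : has_cderiv f z l ->
  exists m, has_cderiv (fun y => (f y ^ n)%C) z m.
Proof.
intros H; induction n as [|n [m IH]].
- exists (RtoC 0); exact (has_cderiv_const (RtoC 1) z).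
- eexists; exact (has_cderiv_mult f (fun y => (f y ^ n)%C) z _ _ H IH).
Qed.

Lemma phase_sum_analytic (n : nat) (q : R) (beta : nat -> R) (J : nat) : 0 < q ->
  analytic_on_disk (phase_sum n q beta J).
Proof.
intros Hq z Hz.
assert (Hj : forall j, exists l,
  has_cderiv (fun y => eitheta (- beta j) * ray_kernel (q ^ j) y ^ S n)%C z l).
{ intros j.
  destruct (ray_kernel_derivable (q ^ j) z Hz (pow_lt _ _ Hq)) as [l1 H1].
  destruct (has_cderiv_pow _ _ _ (S n) H1) as [l2 H2].
  eexists; apply has_cderiv_mult; [apply has_cderiv_const | exact H2]. }
induction J as [|J [l IH]].
- destruct (Hj 0%nat) as [l H]; exists l.
  eapply is_derive_ext; [|exact H]; intros y; unfold phase_sum; now rewrite sum_O.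
- destruct (Hj (S J)) as [l' H]; eexists.
  eapply is_derive_ext; [|exact (has_cderiv_plus _ _ z _ _ IH H)].
  intros y; unfold phase_sum; now rewrite sum_Sn.
Qed.

(* On the disc [Re (1 - z) > 0], so [|1 - z + v|^2 >= |1 - z|^2 + v^2]. *)
Lemma Cmod_ray_kernel_le (v : R) (z : C) : in_disk z -> 0 < v ->
  0 < Cmod (1 - z)%C /\
  Cmod (ray_kernel v z) <= 4 * (Cmod (1 - z)%C * v / (Cmod (1 - z)%C ^ 2 + v ^ 2)) <= 2.
Proof.
intros Hz Hv.
assert (Hden := ray_kernel_denominator v z Hz Hv).
assert (Hre := disk_fst_lt_1 z Hz).
assert (Hsq : forall w : C, Cmod w ^ 2 = fst w ^ 2 + snd w ^ 2).
{ intros w; unfold Cmod; rewrite pow2_sqrt; [reflexivity|]. nra. }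
assert (Hs : 0 < Cmod (1 - z)%C).
{ apply Cmod_gt_0; intros E; apply (f_equal fst) in E; simpl in E; lra. }
split; [exact Hs|].
unfold ray_kernel.
rewrite !Cmod_mult, Cmod_inv by now apply Cmult_neq_0.
rewrite Cmod_R, (Rabs_pos_eq (4 * v)), Cmod_mult by lra.
assert (Hlow : Cmod (1 - z)%C ^ 2 + v ^ 2
  <= Cmod (1 - z + RtoC v)%C * Cmod (1 - z + RtoC v)%C).
{ replace (Cmod (1 - z + RtoC v)%C * Cmod (1 - z + RtoC v)%C)
    with (Cmod (1 - z + RtoC v)%C ^ 2) by ring.
  rewrite !Hsq; simpl; nra. }
set (s := Cmod (1 - z)%C) in *.
assert (Hsv : 0 < s * v) by (apply Rmult_lt_0_compat; lra).
assert (Hss : 0 < s ^ 2 + v ^ 2) by nra.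
split.
- replace (4 * v * s) with (4 * (s * v)) by ring.
  unfold Rdiv; rewrite Rmult_assoc; apply Rmult_le_compat_l; [lra|].
  apply Rmult_le_compat_l; [lra|]; now apply Rinv_le_contravar.
- apply Rmult_le_reg_r with (s ^ 2 + v ^ 2); [lra|].
  replace (4 * (s * v / (s ^ 2 + v ^ 2)) * (s ^ 2 + v ^ 2)) with (4 * (s * v))
    by (field; lra).
  assert (H := pow2_ge_0 (s - v)); lra.
Qed.

Lemma Cmod_sum_n_le (a : nat -> C) (b : nat -> R) (J : nat) :
  (forall j, Cmod (a j) <= b j) ->
  Cmod (sum_n (G := C_AbelianMonoid) a J) <= sum_f_R0 b J.
Proof.
intros H; induction J as [|J IH].
- rewrite sum_O; apply H.
- rewrite sum_Sn, tech5.
  eapply Rle_trans; [apply Cmod_triangle|]; now apply Rplus_le_compat.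
Qed.

(** Of the n + 1 factors in each kernel power, n are bounded by 2 and the last by a term of
    [sum_geometric_kernel]. The bound is thus free of J, [beta] and z. *)
Lemma phase_sum_bounded (n : nat) (q : R) (beta : nat -> R) (J : nat) (z : C) :
  0 < q < 1 -> in_disk z -> Cmod (phase_sum n q beta J z) <= 2 ^ n * (8 / (1 - q)).
Proof.
intros Hq Hz; unfold phase_sum.
assert (Hqj : forall j, 0 < q ^ j) by (intros j; apply pow_lt; lra).
set (s := Cmod (1 - z)%C).
assert (Hs : 0 < s) by (apply (Cmod_ray_kernel_le 1 z Hz); lra).
eapply Rle_trans; [apply Cmod_sum_n_le with
  (b := fun j => (s * q ^ j / (s ^ 2 + (q ^ j) ^ 2)) * (2 ^ n * 4))|].
- intros j.
  destruct (Cmod_ray_kernel_le (q ^ j) z Hz (Hqj j)) as [_ [H1 H2]]; fold s in H1, H2.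
  rewrite Cmod_mult, Cmod_eitheta, Cmod_pow, Rmult_1_l; simpl pow at 1.
  assert (H3 := Cmod_ge_0 (ray_kernel (q ^ j) z)).
  assert (H4 : Cmod (ray_kernel (q ^ j) z) ^ n <= 2 ^ n) by (apply pow_incr; lra).
  assert (H5 : 0 <= Cmod (ray_kernel (q ^ j) z) ^ n) by now apply pow_le.
  eapply Rle_trans; [apply Rmult_le_compat; [exact H3 | exact H5 | exact H1 | exact H4]|].
  apply Req_le; ring.
- rewrite <- scal_sum.
  replace (2 ^ n * (8 / (1 - q))) with (2 ^ n * 4 * (2 / (1 - q))) by (field; lra).
  apply Rmult_le_compat_l; [|now apply sum_geometric_kernel].
  assert (0 < 2 ^ n) by (apply pow_lt; lra); lra.
Qed.

Lemma ray_kernel_real (v r : R) : r < 1 -> 0 < v ->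
  ray_kernel v (RtoC r) = RtoC (4 * ((1 - r) * v) / (1 - r + v) ^ 2).
Proof.
intros Hr Hv; unfold ray_kernel.
rewrite <- RtoC_minus, <- RtoC_plus, <- !RtoC_mult, <- RtoC_inv, <- RtoC_mult.
- f_equal; field; lra.
- apply Rmult_integral_contrapositive_currified; lra.
Qed.

(** On the radius the kernels are real, so only the phases interact. The result is the sum in
    [sum_cos_lower_bound] with u = 1 - r. *)
Lemma phase_sum_real (n : nat) (q : R) (beta : nat -> R) (J : nat) (r alpha : R) :
  0 < q -> r < 1 ->
  fst (phase_sum n q beta J (RtoC r) * eitheta alpha)%C =
  sum_f_R0 (fun j => (4 * ((1 - r) * q ^ j) / (1 - r + q ^ j) ^ 2) ^ S n
                     * cos (alpha - beta j)) J.
Proof.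
intros Hq Hr; unfold phase_sum.
assert (Hj : forall j,
  fst (eitheta (- beta j) * ray_kernel (q ^ j) (RtoC r) ^ S n * eitheta alpha)%C
  = (4 * ((1 - r) * q ^ j) / (1 - r + q ^ j) ^ 2) ^ S n * cos (alpha - beta j)).
{ intros j; rewrite ray_kernel_real by (try apply pow_lt; lra).
  rewrite <- RtoC_pow.
  rewrite (Cmult_comm (eitheta (- beta j))), <- Cmult_assoc, <- eitheta_plus.
  replace (- beta j + alpha) with (alpha - beta j) by ring.
  unfold RtoC, eitheta, Cmult; simpl; ring. }
induction J as [|J IH].
- rewrite sum_O; apply (Hj 0%nat).
- rewrite sum_Sn, tech5, <- IH, <- (Hj (S J)).
  change (@plus C_AbelianMonoid) with Cplus.
  rewrite Cmult_plus_distr_r; reflexivity.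
Qed.

(** * Bloch functions along a ray *)

(** In the variable x = -ln (1 - r), dr/dx = 1 - r <= 1 - r^2, so the Bloch bound on h' bounds the
    derivative by M and the mean value theorem applies. The squared form is the hypothesis of
    [sum_cos_lower_bound]. *)
Lemma Bloch_ray_lipschitz (h hp : C -> C) (M theta r s : R) :
  (forall z, in_disk z -> has_cderiv h z (hp z)) ->
  (forall z, in_disk z -> (1 - Cmod z ^ 2) * Cmod (hp z) <= M) ->
  0 <= r < 1 -> 0 <= s < 1 ->
  (snd (h (RtoC r * eitheta theta)%C) - snd (h (RtoC s * eitheta theta)%C)) ^ 2
  <= M ^ 2 * (ln (1 - r) - ln (1 - s)) ^ 2.
Proof.
intros Hh HM Hr Hs.
set (w := eitheta theta).
assert (Hray : forall t, 0 <= t < 1 -> in_disk (RtoC t * w)%C /\ Cmod (RtoC t * w)%C = t).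
{ intros t Ht; unfold in_disk, w; rewrite Cmod_mult, Cmod_eitheta, Cmod_R, Rabs_pos_eq; lra. }
assert (HM0 : 0 <= M).
{ eapply Rle_trans; [|apply (HM _ (proj1 (Hray 0 ltac:(lra))))].
  rewrite (proj2 (Hray 0 ltac:(lra))); apply Rmult_le_pos; [lra | apply Cmod_ge_0]. }
(* The substitution [r = 1 - e^-x] makes Im h Lipschitz. *)
set (b := fun x => snd (h (RtoC (1 - exp (- x)) * w)%C)).
set (db := fun x => exp (- x) * snd (w * hp (RtoC (1 - exp (- x)) * w))%C).
assert (Hrange : forall x, 0 <= x -> 0 <= 1 - exp (- x) < 1).
{ intros x Hx; assert (H := exp_pos (- x)).
  assert (exp (- x) <= 1); [|lra].
  rewrite <- exp_0; destruct (Req_dec x 0) as [->|];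
   [rewrite Ropp_0; lra | apply Rlt_le, exp_increasing; lra]. }
assert (Hder : forall x, 0 <= x -> is_derive b x (db x)).
{ intros x Hx.
  apply (is_derive_comp (K := R_AbsRing) (V := R_NormedModule)
    (fun t => snd (h (RtoC t * w)%C)) (fun x => 1 - exp (- x))).
  - apply is_derive_ray_im, Hh, Hray, Hrange, Hx.
  - auto_derive; [exact I | ring]. }
assert (Hbd : forall x, 0 <= x -> Rabs (db x) <= M).
{ intros x Hx; unfold db.
  destruct (Hray _ (Hrange x Hx)) as [Hd Hmod].
  assert (HMx := HM _ Hd); rewrite Hmod in HMx.
  assert (He := exp_pos (- x)); assert (Hx1 := Hrange x Hx).
  set (e := exp (- x)) in *; set (d := hp (RtoC (1 - e) * w)%C) in *.
  rewrite Rabs_mult, (Rabs_pos_eq e) by lra.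
  assert (Hsnd : Rabs (snd (w * d)%C) <= Cmod d).
  { replace (Cmod d) with (Cmod (w * d)%C)
      by (unfold w; rewrite Cmod_mult, Cmod_eitheta; ring).
    eapply Rle_trans; [apply Rmax_r | apply Rmax_Cmod]. }
  assert (Hd0 := Cmod_ge_0 d).
  apply Rle_trans with (e * Cmod d); [apply Rmult_le_compat_l; lra|].
  eapply Rle_trans; [|exact HMx]; apply Rmult_le_compat_r; nra. }
assert (Hb : forall t, 0 <= t < 1 -> 0 <= - ln (1 - t) /\
   snd (h (RtoC t * w)%C) = b (- ln (1 - t))).
{ intros t Ht; split.
  - destruct (Req_dec t 0) as [->|]; [rewrite Rminus_0_r, ln_1; lra|].
    assert (L := ln_increasing (1 - t) 1); rewrite ln_1 in L; lra.
  - unfold b; rewrite Ropp_involutive, exp_ln by lra.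
    now replace (1 - (1 - t)) with t by ring. }
destruct (Hb r Hr) as [Hxr ->]; destruct (Hb s Hs) as [Hxs ->].
set (x := - ln (1 - r)) in *; set (y := - ln (1 - s)) in *.
replace (ln (1 - r) - ln (1 - s)) with (y - x) by (unfold x, y; ring).
assert (Hmin : 0 <= Rmin y x) by (apply Rmin_glb; lra).
destruct (MVT_gen b y x db) as [c [Hc ->]].
- intros z Hz; apply Hder; lra.
- intros z Hz; apply continuity_pt_filterlim.
  apply (ex_derive_continuous b); exists (db z); apply Hder; lra.
- rewrite Rpow_mult_distr; replace ((x - y) ^ 2) with ((y - x) ^ 2) by ring.
  apply Rmult_le_compat_r; [apply pow2_ge_0|].
  rewrite <- pow2_abs; apply pow_incr; split; [apply Rabs_pos | apply Hbd; lra].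
Qed.

(** * Radial integrals and test functions *)

Lemma polar_in_disk (t theta : R) : 0 <= t < 1 ->
  Cmod (RtoC t * eitheta theta)%C = t /\ in_disk (RtoC t * eitheta theta)%C.
Proof.
intros Ht; unfold in_disk.
rewrite Cmod_mult, Cmod_eitheta, Cmod_R, Rabs_pos_eq by lra; lra.
Qed.

Lemma in_disk_scale (s : R) (z : C) : 0 <= s <= 1 -> in_disk z -> in_disk (RtoC s * z)%C.
Proof.
intros Hs Hz; unfold in_disk in *; rewrite Cmod_mult, Cmod_R, Rabs_pos_eq by lra.
assert (H := Cmod_ge_0 z); nra.
Qed.

Lemma weight_inverse (nu : R -> R) (F : C -> C) (r : R) : 0 <= nu r ->
  Cmult (RtoC (nu r)) (F (RtoC r)) = RtoC 1 ->
  0 < nu r /\ F (RtoC r) = RtoC (/ nu r).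
Proof.
intros Hr HF.
assert (Hn : nu r <> 0).
{ intros E; rewrite E, Cmult_0_l in HF; apply (f_equal fst) in HF; simpl in HF; lra. }
split; [lra|].
assert (HC : RtoC (nu r) <> RtoC 0) by (intros E; apply RtoC_inj in E; lra).
rewrite RtoC_inv by exact Hn.
rewrite <- (Cmult_1_l (/ _)%C), <- HF; field; exact HC.
Qed.

(** Integrability must be known before [RInt] means anything. Continuity of g' on the segment is
    read off from g' = e^h, h being complex differentiable. *)
Lemma Tg_is_RInt (gp h f : C -> C) (z : C) :
  analytic_on_disk h -> (forall w, in_disk w -> cexp (h w) = gp w) ->
  analytic_on_disk f -> in_disk z ->
  is_RInt (V := C_R_NormedModule)
    (fun s : R => (f (RtoC s * z) * gp (RtoC s * z) * z)%C) 0 1 (Tg gp f z).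
Proof.
intros Hh Hexp Hf Hz.
apply (RInt_correct (V := C_R_CompleteNormedModule)).
apply (ex_RInt_ext (V := C_R_NormedModule)
  (fun s : R => (f (RtoC s * z) * cexp (h (RtoC s * z)) * z)%C)).
{ rewrite Rmin_left, Rmax_right by lra; intros s Hs.
  rewrite Hexp; [reflexivity | apply in_disk_scale; [lra | exact Hz]]. }
apply (ex_RInt_continuous (V := C_R_CompleteNormedModule)).
rewrite Rmin_left, Rmax_right by lra; intros s Hs.
assert (Hsz := in_disk_scale s z Hs Hz).
destruct (Hf _ Hsz) as [lf Hlf]; destruct (Hh _ Hsz) as [lh Hlh].
apply (continuous_Cmult _ (fun _ => z)); [|apply continuous_const].
apply continuous_Cmult.
- exact (continuous_ray f z s lf Hlf).
- apply continuous_cexp, (continuous_ray h z s lh Hlh).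
Qed.

(** The substitution r = t s brings the radial integral to the interval [0,1] of [Tg], so that the
    two integrands can be compared pointwise. *)
Lemma ray_integral_rescaled (gp h F : C -> C) (nu : R -> R) (t theta : R) :
  analytic_on_disk h -> (forall w, in_disk w -> cexp (h w) = gp w) ->
  analytic_on_disk F -> (forall r, 0 <= r < 1 -> F (RtoC r) = RtoC (/ nu r)) ->
  0 <= t < 1 ->
  is_RInt (fun s => t * (Cmod (gp (RtoC (t * s) * eitheta theta)%C) / nu (t * s))) 0 1
    (RInt (fun r => Cmod (gp (RtoC r * eitheta theta)%C) / nu r) 0 t).
Proof.
intros Hh Hexp HF Hnu Ht.
set (G := fun r => Cmod (gp (RtoC r * eitheta theta)%C) / nu r).
assert (HG : ex_RInt G 0 t).
(* The integrand is |e^h| times Re F, both continuous on the ray. The factor [RtoC 1] gives F the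
   shape required by [continuous_ray]. *)
{ apply ex_RInt_ext with (fun r : R =>
    Cmod (cexp (h (RtoC r * eitheta theta)%C)) * fst (F (RtoC r * RtoC 1)%C)).
  { rewrite Rmin_left, Rmax_right by lra; intros r Hr; unfold G, Rdiv.
    rewrite Hexp by (apply polar_in_disk; lra).
    rewrite Cmult_1_r, Hnu by lra; reflexivity. }
  apply (ex_RInt_continuous (V := R_CompleteNormedModule)).
  rewrite Rmin_left, Rmax_right by lra; intros r Hr.
  assert (Hr1 : 0 <= r < 1) by lra.
  destruct (Hh _ (proj2 (polar_in_disk r theta Hr1))) as [lh Hlh].
  assert (Hd : in_disk (RtoC r * RtoC 1)%C).
  { unfold in_disk; rewrite Cmult_1_r, Cmod_R, Rabs_pos_eq; lra. }
  destruct (HF _ Hd) as [lF HlF].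
  apply (continuous_mult (K := R_AbsRing)).
  - apply continuous_Cmod, continuous_cexp, (continuous_ray h _ r lh Hlh).
  - apply (continuous_comp (fun r : R => F (RtoC r * RtoC 1)%C) fst);
      [exact (continuous_ray F _ r lF HlF) | apply continuous_fst]. }
apply (RInt_correct (V := R_CompleteNormedModule)) in HG.
apply is_RInt_ext with (fun s => scal t (G (t * s + 0))).
{ intros s _; now rewrite Rplus_0_r. }
apply (is_RInt_comp_lin G t 0 0 1).
replace (t * 0 + 0) with 0 by ring; replace (t * 1 + 0) with t by ring; exact HG.
Qed.

Lemma analytic_rotate (f : C -> C) (theta : R) : analytic_on_disk f ->
  analytic_on_disk (fun z => f (eitheta theta * z)%C).
Proof.
intros Hf z Hz.
assert (Hd : in_disk (eitheta theta * z)%C).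
{ unfold in_disk; now rewrite Cmod_mult, Cmod_eitheta, Rmult_1_l. }
destruct (Hf _ Hd) as [l Hl]; eexists.
apply (has_cderiv_comp f); [exact Hl|].
apply (has_cderiv_mult (fun _ => eitheta theta) (fun y => y));
  [apply has_cderiv_const | apply has_cderiv_id].
Qed.

Lemma analytic_mult (f g : C -> C) : analytic_on_disk f -> analytic_on_disk g ->
  analytic_on_disk (fun z => f z * g z)%C.
Proof.
intros Hf Hg z Hz; destruct (Hf z Hz) as [a Ha]; destruct (Hg z Hz) as [b Hb].
eexists; exact (has_cderiv_mult f g z a b Ha Hb).
Qed.

(** * Sufficiency of the radial condition *)

Lemma Tg_bounded_sufficient (gp h F : C -> C) (nu mu : R -> R) (M : R) :
  analytic_on_disk h -> (forall w, in_disk w -> cexp (h w) = gp w) ->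
  analytic_on_disk F ->
  (forall r, 0 <= r < 1 -> 0 < nu r /\ F (RtoC r) = RtoC (/ nu r)) ->
  (forall r, 0 <= r < 1 -> 0 <= mu r) ->
  (forall t theta : R, 0 <= t < 1 -> 0 <= theta < 2 * PI ->
    mu t * RInt (fun r => Cmod (gp (RtoC r * eitheta theta)%C) / nu r) 0 t <= M) ->
  Tg_bounded gp nu mu.
Proof.
intros Hh Hexp HF Hnu Hmu HM; exists M; intros f Hf A HA z Hz.
assert (HT := Tg_is_RInt gp h f z Hh Hexp Hf Hz).
destruct (polar_form z) as [theta [Hth Ez]].
assert (Ht : 0 <= Cmod z < 1) by (split; [apply Cmod_ge_0 | exact Hz]).
set (t := Cmod z) in *.
assert (HR := ray_integral_rescaled gp h F nu t theta Hh Hexp HF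
  (fun r Hr => proj2 (Hnu r Hr)) Ht).
assert (HMt := HM t theta Ht Hth).
set (I := RInt _ 0 t) in *.
(* A is merely some upper bound of nu |f|; its sign, read at the centre, allows the radial condition
   to be multiplied by A at the end. *)
assert (HA0 : 0 <= A).
{ eapply Rle_trans; [|apply (HA (RtoC 0)); unfold in_disk; rewrite Cmod_0; lra].
  apply Rmult_le_pos; [|apply Cmod_ge_0].
  rewrite Cmod_0; apply Rlt_le, Hnu; lra. }
apply (is_RInt_scal _ _ _ A) in HR.
assert (HTI : Cmod (Tg gp f z) <= A * I).
{ rewrite <- norm_C_R.
  apply (norm_RInt_le (V := C_R_NormedModule) _ _ 0 1 _ _ Rle_0_1) with (2 := HT) (3 := HR).
  intros s Hs; rewrite norm_C_R, !Cmod_mult.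
  change (Cmod (f (RtoC s * z)%C) * Cmod (gp (RtoC s * z)%C) * t
    <= A * (t * (Cmod (gp (RtoC (t * s) * eitheta theta)%C) / nu (t * s)))).
  assert (Es : (RtoC (t * s) * eitheta theta)%C = (RtoC s * z)%C).
  { rewrite Ez, RtoC_mult; ring. }
  rewrite Es.
  assert (Hts : 0 <= t * s < 1) by nra.
  assert (Hd := in_disk_scale s z Hs Hz).
  assert (HAs := HA _ Hd).
  rewrite Cmod_mult, Cmod_R, Rabs_pos_eq in HAs by lra.
  fold t in HAs; rewrite (Rmult_comm s t) in HAs.
  assert (Hn := proj1 (Hnu _ Hts)).
  assert (Hgp := Cmod_ge_0 (gp (RtoC s * z)%C)).
  assert (Hff : Cmod (f (RtoC s * z)%C) <= A / nu (t * s)).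
  { apply Rmult_le_reg_l with (nu (t * s)); [exact Hn|].
    replace (nu (t * s) * (A / nu (t * s))) with A by (field; lra); exact HAs. }
  replace (A * (t * (Cmod (gp (RtoC s * z)%C) / nu (t * s))))
    with (A / nu (t * s) * (Cmod (gp (RtoC s * z)%C) * t)) by (field; lra).
  rewrite Rmult_assoc; apply Rmult_le_compat_r; [apply Rmult_le_pos; lra | exact Hff]. }
assert (Hm := Hmu t Ht).
apply Rle_trans with (mu t * (A * I)); [now apply Rmult_le_compat_l|].
replace (mu t * (A * I)) with (mu t * I * A) by ring.
now apply Rmult_le_compat_r.
Qed.

(** * Necessity of the radial condition *)

Lemma Tg_bounded_necessary (gp h hp F : C -> C) (nu mu : R -> R) (B : R) :
  (forall z, in_disk z -> has_cderiv h z (hp z)) ->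
  (forall z, in_disk z -> (1 - Cmod z ^ 2) * Cmod (hp z) <= B) ->
  (forall w, in_disk w -> cexp (h w) = gp w) ->
  analytic_on_disk F ->
  (forall r, 0 <= r < 1 -> 0 < nu r /\ F (RtoC r) = RtoC (/ nu r)) ->
  (forall z, in_disk z -> Cmod (F z) <= fst (F (RtoC (Cmod z)))) ->
  (forall r, 0 <= r < 1 -> 0 <= mu r) ->
  Tg_bounded gp nu mu ->
  exists M : R, forall t theta : R, 0 <= t < 1 ->
    mu t * RInt (fun r => Cmod (gp (RtoC r * eitheta theta)%C) / nu r) 0 t <= M.
Proof.
intros Hhp HB Hexp HF Hnu HFmax Hmu [K HK].
assert (Hh : analytic_on_disk h) by (intros z Hz; exists (hp z); now apply Hhp).
assert (HB0 : 0 <= B).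
{ assert (H0 : in_disk (RtoC 0)) by (unfold in_disk; rewrite Cmod_0; lra).
  eapply Rle_trans; [|apply (HB _ H0)].
  rewrite Cmod_0; assert (H := Cmod_ge_0 (hp (RtoC 0))); lra. }
destruct (sum_cos_lower_bound B HB0) as [n Hn].
set (q := 1 - / (2 * INR (S n))) in *.
assert (HN : 1 <= INR (S n)) by (apply (le_INR 1); lia).
assert (Hq : 0 < q < 1).
{ assert (0 < / (2 * INR (S n)) <= / 2); [|unfold q; lra].
  split; [apply Rinv_0_lt_compat | apply Rinv_le_contravar]; lra. }
(* The bound from [phase_sum_bounded]. It also bounds the norm of the test function, because nu |F|
   <= 1; the factor 8 in the next line undoes the 1/8 lost in the phase cancellation. *)
set (A := 2 ^ n * (8 / (1 - q))).
exists (8 * (K * A)); intros t theta Ht.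
set (e := eitheta theta).
set (a := fun r : R => snd (h (RtoC r * e)%C)).
set (beta := fun j => a (1 - q ^ j)).
(* With q^J < 1 - t, every r in [0,t] has 1 - r in [q^J, 1], the range covered by the nodes. *)
destruct (pow_lt_1_zero q) with (y := 1 - t) as [J HJ];
  [rewrite Rabs_pos_eq; lra | lra |].
specialize (HJ J (Nat.le_refl J)).
assert (HqJ : 0 < q ^ J) by (apply pow_lt; lra).
rewrite Rabs_pos_eq in HJ by lra.
(* On the ray, the phase sum nearly cancels the argument of g' = exp h. *)
assert (Hphase : forall r, 0 <= r <= t ->
  1 / 8 <= fst (phase_sum n q beta J (RtoC r) * eitheta (a r))%C).
{ intros r Hr; rewrite phase_sum_real by lra.
  apply Hn; [fold q; lra|].
  intros j; fold q.
  assert (Hqj : 0 < q ^ j <= 1).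
  { split; [apply pow_lt; lra|].
    rewrite <- (pow1 j); apply pow_incr; lra. }
  replace (q ^ j) with (1 - (1 - q ^ j)) by ring.
  apply (Bloch_ray_lipschitz h hp B theta r (1 - q ^ j) Hhp HB); lra. }
(* The inner rotation carries the ray to the radius [0,1). The outer factor cancels the e^{i theta}
   contributed by the factor z in [Tg]. *)
set (f := fun z => (eitheta (- theta) * (F (eitheta (- theta) * z)
                    * phase_sum n q beta J (eitheta (- theta) * z)))%C).
assert (Hf : analytic_on_disk f).
{ apply analytic_mult.
  - intros z _; eexists; apply has_cderiv_const.
  - apply (analytic_rotate (fun z => F z * phase_sum n q beta J z)%C).
    apply analytic_mult; [exact HF | now apply phase_sum_analytic]. }
assert (HfA : forall z, in_disk z -> nu (Cmod z) * Cmod (f z) <= A).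
{ intros z Hz; unfold f.
  assert (Hm : Cmod (eitheta (- theta) * z)%C = Cmod z)
    by (rewrite Cmod_mult, Cmod_eitheta; ring).
  assert (Hd : in_disk (eitheta (- theta) * z)%C)
    by (unfold in_disk; now rewrite Hm).
  rewrite Cmod_mult, Cmod_eitheta, Rmult_1_l, Cmod_mult.
  assert (HFz := HFmax _ Hd); rewrite Hm in HFz.
  assert (HkA := phase_sum_bounded n q beta J _ Hq Hd); fold A in HkA.
  assert (Hz1 : 0 <= Cmod z < 1) by (split; [apply Cmod_ge_0 | exact Hz]).
  destruct (Hnu _ Hz1) as [Hpos E]; rewrite E in HFz; simpl fst in HFz.
  assert (Hk0 := Cmod_ge_0 (phase_sum n q beta J (eitheta (- theta) * z)%C)).
  assert (HF0 := Cmod_ge_0 (F (eitheta (- theta) * z)%C)).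
  set (k := Cmod (phase_sum _ _ _ _ _)) in *; set (Fz := Cmod (F _)) in *.
  apply Rmult_le_compat_l with (r := nu (Cmod z)) in HFz; [|lra].
  rewrite Rinv_r in HFz by lra.
  rewrite <- Rmult_assoc; apply Rle_trans with (1 * k); [|lra].
  now apply Rmult_le_compat_r. }
set (z := (RtoC t * e)%C).
destruct (polar_in_disk t theta Ht) as [Hzt Hz]; fold e in Hzt, Hz; fold z in Hzt, Hz.
assert (HKz := HK f Hf A HfA z Hz); rewrite Hzt in HKz.
assert (HT := Tg_is_RInt gp h f z Hh Hexp Hf Hz).
assert (HR := ray_integral_rescaled gp h F nu t theta Hh Hexp HF
  (fun r Hr => proj2 (Hnu r Hr)) Ht).
fold e in HR.
set (I := RInt _ 0 t) in *.
apply (is_RInt_scal _ _ _ (1 / 8)) in HR.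
apply (is_RInt_fct_extend_fst (U := R_NormedModule) (V := R_NormedModule)) in HT.
assert (HI : 1 / 8 * I <= fst (Tg gp f z)).
(* At r = t s the integrand of [Tg] collapses to (t |g'| / nu(r)) k(r) e^{i a(r)}, with g' taken at
   r e^{i theta}; [Hphase] bounds its real part below. *)
{ apply (is_RInt_le _ _ 0 1 _ _ Rle_0_1 HR HT).
  intros s Hs.
  assert (Hts : 0 <= t * s <= t) by nra.
  assert (Ets : (RtoC s * z)%C = (RtoC (t * s) * e)%C)
    by (unfold z; rewrite RtoC_mult; ring).
  rewrite Ets.
  change (1 / 8 * (t * (Cmod (gp (RtoC (t * s) * e)%C) / nu (t * s)))
   <= fst (f (RtoC (t * s) * e) * gp (RtoC (t * s) * e) * z)%C).
  set (r := t * s) in *.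
  assert (Hr1 : 0 <= r < 1) by lra.
  destruct (Hnu r Hr1) as [Hpos EF].
  assert (Ed : (eitheta (- theta) * (RtoC r * e))%C = RtoC r).
  { replace (eitheta (- theta) * (RtoC r * e))%C
      with (RtoC r * (eitheta (- theta) * e))%C by ring.
    unfold e; rewrite eitheta_opp_l; ring. }
  assert (Egp : gp (RtoC r * e)%C
    = (RtoC (Cmod (gp (RtoC r * e)%C)) * eitheta (a r))%C).
  { rewrite <- Hexp by now apply polar_in_disk.
    rewrite Cmod_cexp, cexp_polar; reflexivity. }
  assert (Hg0 := Cmod_ge_0 (gp (RtoC r * e)%C)).
  set (m := Cmod (gp (RtoC r * e)%C)) in *.
  unfold f; rewrite Ed, EF, Egp.
  set (k := phase_sum n q beta J (RtoC r)).
  replace (eitheta (- theta) * (RtoC (/ nu r) * k) * (RtoC m * eitheta (a r)) * z)%C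
    with (RtoC (/ nu r * m * t) * (k * eitheta (a r)))%C.
  2:{ unfold z; rewrite !RtoC_mult.
      transitivity ((eitheta (- theta) * e) * (RtoC (/ nu r) * k)
        * (RtoC m * eitheta (a r)) * RtoC t)%C; [|ring].
      unfold e; rewrite eitheta_opp_l; ring. }
  assert (Hp := Hphase r Hts); fold k in Hp.
  set (w := (k * eitheta (a r))%C) in *.
  replace (fst (RtoC (/ nu r * m * t) * w)%C) with (/ nu r * m * t * fst w)
    by (simpl; ring).
  replace (1 / 8 * (t * (m / nu r))) with (/ nu r * m * t * (1 / 8))
    by (unfold Rdiv; ring).
  apply Rmult_le_compat_l; [|exact Hp].
  assert (0 < / nu r) by now apply Rinv_0_lt_compat.
  repeat apply Rmult_le_pos; lra. }
assert (HTre : fst (Tg gp f z) <= Cmod (Tg gp f z)).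
{ eapply Rle_trans; [apply Rle_abs | apply re_le_Cmod]. }
assert (Hm := Hmu t Ht).
assert (Hfin : mu t * (1 / 8 * I) <= mu t * Cmod (Tg gp f z))
  by (apply Rmult_le_compat_l; lra).
lra.
Qed.

Theorem theorem1 (g gp : C -> C) (nu mu : R -> R)
  (Hg : forall z, in_disk z -> has_cderiv g z (gp z))
  (Hlog : log_in_Bloch gp)
  (Hnu : analytic_weight nu)
  (Hmu : weight mu) :
  Tg_bounded gp nu mu <->
  exists M : R, forall t theta : R, 0 <= t < 1 -> 0 <= theta < 2 * PI ->
    mu t * RInt (fun r => Cmod (gp (Cmult (RtoC r) (eitheta theta))) / nu r) 0 t <= M.
Proof.
destruct Hlog as [h [Hexp [hp [Hhp [B HB]]]]].
destruct Hnu as [[Hnu0 _] [F [HF [HF1 HFmax]]]].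
destruct Hmu as [Hmu0 _].
assert (Hinv : forall r, 0 <= r < 1 -> 0 < nu r /\ F (RtoC r) = RtoC (/ nu r)).
{ intros r Hr; apply weight_inverse; [now apply Hnu0 | now apply HF1]. }
split.
- intros Hb.
  destruct (Tg_bounded_necessary gp h hp F nu mu B) as [M HM]; try assumption.
  + intros z Hz; assert (H := HB z Hz).
    assert (H0 := Cmod_ge_0 (h (RtoC 0))); lra.
  + exists M; intros t theta Ht _; now apply HM.
- intros [M HM].
  apply (Tg_bounded_sufficient gp h F nu mu M); try assumption.
  intros z Hz; exists (hp z); now apply Hhp.
Qed.
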